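(* If $(\mathcal{A},\mu,\alpha)$ is an involutive Hom-Novikov algebra (that is, a Hom-Novikov algebra with $\alpha^2=\mathrm{id}$), then $(\mathcal{A},\alpha\circ\mu)$ is a Novikov algebra.
   Context: All vector spaces are over a field $\mathbb{F}$ of characteristic zero. A Novikov algebra $(\mathcal{A},\mu)$ is a vector space with a bilinear product $\mu(x,y)=xy$ satisfying $(xy)z=(xz)y$ and $(xy)z-x(yz)=(yx)z-y(xz)$ for all $x,y,z\in\mathcal{A}$. A Hom-Novikov algebra is a triple $(\mathcal{A},\mu,\alpha)$ consisting of a vector space $\mathcal{A}$, a bilinear map $\mu:\mathcal{A}\times\mathcal{A}\to\mathcal{A}$, $\mu(x,y)=xy$, and an algebra homomorphism $\alpha:\mathcal{A}\to\mathcal{A}$ (linear with $\alpha(xy)=\alpha(x)\alpha(y)$) such that for all $x,y,z\in\mathcal{A}$: $(xy)\alpha(z)=(xz)\alpha(y)$ and $(xy)\alpha(z)-\alpha(x)(yz)=(yx)\alpha(z)-\alpha(y)(xz)$. $(\alpha\circ\mu)(x,y)=\alpha(\mu(x,y))$. *)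

(* Defs.v *)
From mathcomp Require Import all_boot all_algebra.

Set Implicit Arguments.
Unset Strict Implicit.
Unset Printing Implicit Defensive.

Local Open Scope ring_scope.

(* The product mu is an explicit operation rather than a MathComp ring
   multiplication because it is neither associative nor unital. *)
Record novikov_algebra (F : fieldType) (A : lmodType F)
    (mu : A -> A -> A) : Prop := NovikovAlgebra {
  novikov_bilinear : bilinear_for *:%R *:%R mu;
  novikov_right_comm : forall x y z : A, mu (mu x y) z = mu (mu x z) y;
  novikov_left_symm : forall x y z : A,
    mu (mu x y) z - mu x (mu y z) = mu (mu y x) z - mu y (mu x z)
}.

Record hom_novikov_algebra (F : fieldType) (A : lmodType F)
    (mu : A -> A -> A) (alpha : A -> A) : Prop := HomNovikovAlgebra {
  hom_novikov_bilinear : bilinear_for *:%R *:%R mu;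
  hom_novikov_linear : linear alpha;
  hom_novikov_morph : {morph alpha : x y / mu x y};
  hom_novikov_right_comm : forall x y z : A,
    mu (mu x y) (alpha z) = mu (mu x z) (alpha y);
  hom_novikov_left_symm : forall x y z : A,
    mu (mu x y) (alpha z) - mu (alpha x) (mu y z) =
    mu (mu y x) (alpha z) - mu (alpha y) (mu x z)
}.

Record involutive_hom_novikov_algebra (F : fieldType) (A : lmodType F)
    (mu : A -> A -> A) (alpha : A -> A) : Prop := InvolutiveHomNovikovAlgebra {
  involutive_hom_novikov : hom_novikov_algebra mu alpha;
  involutive_hom_novikov_involutive : alpha \o alpha =1 id
}.

(* Main.v *)
Require Import Defs.
From mathcomp Require Import all_boot all_algebra.

(** Write [x * y] for [mu x y] and [x . y] for the twisted product
    [alpha (x * y)].  As [alpha] is multiplicative, an [alpha] applied to a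
    two-fold twisted product can be pushed inside; it then meets the inner
    [alpha] and, [alpha] being involutive, cancels it:
    [(x . y) . z = (x * y) * alpha z] and [x . (y . z) = alpha x * (y * z)].
    The right-hand sides are the monomials of the Hom-Novikov identities, so
    each Novikov identity for the twisted product is literally the matching
    Hom-Novikov identity for [mu]. *)

Theorem proposition3p4 (F : fieldType) (charF0 : [pchar F]%R =i pred0)
  (A : lmodType F) (mu : A -> A -> A) (alpha : A -> A) :
  involutive_hom_novikov_algebra mu alpha ->
  novikov_algebra (fun x y : A => alpha (mu x y)).
Proof.
case=> -[[mu_linl mu_linr] alpha_lin alphaM right_comm left_symm] alphaK.
have twist_l x y z : alpha (mu (alpha (mu x y)) z) = mu (mu x y) (alpha z).
  by rewrite alphaM [alpha (alpha _)]alphaK.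
have twist_r x y z : alpha (mu x (alpha (mu y z))) = mu (alpha x) (mu y z).
  by rewrite alphaM [alpha (alpha _)]alphaK.
split=> [|x y z|x y z].
- split=> [y a u v | x a u v] /=.
  + by rewrite [mu _ y]mu_linl alpha_lin.
  + by rewrite mu_linr alpha_lin.
- by rewrite !twist_l right_comm.
- by rewrite !twist_l !twist_r left_symm.
Qed.
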